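(* Let $A=(a_1,a_2,a_3)$ be a triplet of positive integers with $a_1\le a_2\le a_3$, $\mu_A=a_1+a_2+a_3-1$, $\chi_A=\frac1{a_1}+\frac1{a_2}+\frac1{a_3}-1$. A Frobenius manifold $M$ of rank $\mu_A$ and dimension one with unit vector field $e$ and Euler vector field $E$ given, in flat coordinates $t_1,\ t_{i,j}\ (1\le i\le3,1\le j\le a_i-1),\ t_{\mu_A}$, by $$e=\frac{\partial}{\partial t_1},\qquad E=t_1\frac{\partial}{\partial t_1}+\sum_{i=1}^3\sum_{j=1}^{a_i-1}\frac{a_i-j}{a_i}t_{i,j}\frac{\partial}{\partial t_{i,j}}+\chi_A\frac{\partial}{\partial t_{\mu_A}}$$ is uniquely determined by its intersection form $I_M$; that is, two such Frobenius structures with the same $e$, $E$ and the same intersection form coincide.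
   Context: A Frobenius manifold of rank $\mu$ and dimension $d$ (Dubrovin) is a complex manifold of dimension $\mu$ with a flat non-degenerate symmetric $\mathcal O_M$-bilinear form $\eta$ on the tangent sheaf, an associative commutative product $\circ$ on the tangent sheaf compatible with $\eta$, with $\eta(\partial_a\circ\partial_b,\partial_c)=\partial_a\partial_b\partial_c\mathcal F_M$ in flat coordinates for a local potential $\mathcal F_M$, a flat unit field $e$, and an Euler field $E$ with $\mathrm{Lie}_E(\circ)=\circ$ and $\mathrm{Lie}_E\eta=(2-d)\eta$. Flat coordinates are coordinates in which $\eta$ is constant. The intersection form is $I_M(\omega_1,\omega_2)=i_E(\omega_1\bullet\omega_2)$ for $\omega_1,\omega_2\in\Omega^1_M$, where $\bullet$ is the product on $\Omega_M^1$ obtained from $\circ$ via the identification $\mathcal T_M\cong\Omega_M^1$ given by $\eta$, and $i_E$ is contraction with $E$. In flat coordinates $t_a$, with $\partial_a=\partial/\partial t_a$ and $(\eta^{ab})=(\eta(\partial_a,\partial_b))^{-1}$, $I_M(dt_a,dt_b)=\sum_{k,l}\eta^{ak}\eta^{bl}E(\partial_k\partial_l\mathcal F_M)$. *)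

(* Defs.v *)
From HB Require Import structures.
From mathcomp Require Import all_boot all_order all_algebra.
From mathcomp Require Import complex.
From mathcomp Require Import all_classical all_reals all_analysis.

Set Implicit Arguments.
Unset Strict Implicit.
Unset Printing Implicit Defensive.

Import Order.TTheory GRing.Theory Num.Theory.
Import numFieldNormedType.Exports.
Local Open Scope classical_set_scope.
Local Open Scope ring_scope.

(* Bundled as a numClosedFieldType, so that the topological and normed
   structures of numFieldNormedType apply: differentiability below is therefore
   complex differentiability. *)
Definition Cplx (R : realType) : numClosedFieldType := R[i]%C.

Definition holomorphic_on (R : realType) (n : nat)
    (D : set 'rV[Cplx R]_n) (f : 'rV[Cplx R]_n -> Cplx R) : Prop :=
  forall x, D x -> differentiable f x.

Definition pd (R : realType) (n : nat) (i : 'I_n)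
    (f : 'rV[Cplx R]_n -> Cplx R) (x : 'rV[Cplx R]_n) : Cplx R :=
  'D_(delta_mx 0 i) f x.

(* [coord] and [param] are total functions, meaningful on [dom] and [cod]
   only, where they are mutually inverse homeomorphisms. *)
Record chart (R : realType) (n : nat) (M : topologicalType) := Chart {
  dom : set M;
  cod : set 'rV[Cplx R]_n;
  coord : M -> 'rV[Cplx R]_n;
  param : 'rV[Cplx R]_n -> M;
  open_dom : open dom;
  open_cod : open cod;
  coord_cod : forall p, dom p -> cod (coord p);
  param_dom : forall x, cod x -> dom (param x);
  coordK : forall p, dom p -> param (coord p) = p;
  paramK : forall x, cod x -> coord (param x) = x;
  continuous_coord : {within dom, continuous coord};
  continuous_param : {within cod, continuous param}
}.

Definition transition (R : realType) (n : nat) (M : topologicalType)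
    (phi psi : chart R n M) (x : 'rV[Cplx R]_n) : 'rV[Cplx R]_n :=
  coord psi (param phi x).

(* The points of the coordinate domain of [phi] where [transition phi psi]
   is meaningful. *)
Definition overlap (R : realType) (n : nat) (M : topologicalType)
    (phi psi : chart R n M) : set 'rV[Cplx R]_n :=
  [set x | cod phi x /\ dom psi (param phi x)].

Definition compatible (R : realType) (n : nat) (M : topologicalType)
    (phi psi : chart R n M) : Prop :=
  (forall x, overlap phi psi x -> differentiable (transition phi psi) x) /\
  (forall x, overlap psi phi x -> differentiable (transition psi phi) x).

(* The atlas is maximal, so that "a chart of M" means "any local holomorphic
   coordinate system on M". *)
Record complexManifold (R : realType) (n : nat) := ComplexManifold {
  points :> topologicalType;
  points_hausdorff : hausdorff_space points;
  points_second_countable : @second_countable points;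
  atlas : set (chart R n points);
  atlas_cover : forall p : points, exists2 phi, atlas phi & dom phi p;
  atlas_compatible : forall phi psi, atlas phi -> atlas psi ->
    compatible phi psi;
  atlas_maximal : forall phi,
    (forall psi, atlas psi -> compatible phi psi) -> atlas phi
}.

(* A field on M is the family, over the charts, of its components as functions
   of the coordinates; only the charts of the atlas and the points of their
   coordinate domains are relevant. Tangent vectors are row vectors, and the
   differential of [f] at [x] is [v |-> v *m 'J f x]. *)
Definition fields (R : realType) (n : nat) (M : complexManifold R n)
    (T : Type) : Type :=
  chart R n M -> 'rV[Cplx R]_n -> T.

Definition agree (R : realType) (n : nat) (M : complexManifold R n) (T : Type)
    (s s' : fields M T) : Prop :=
  forall phi, atlas phi -> forall x, cod phi x -> s phi x = s' phi x.

Definition is_vector_field (R : realType) (n : nat) (M : complexManifold R n)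
    (V : fields M 'rV[Cplx R]_n) : Prop :=
  (forall phi, atlas phi -> forall a,
     holomorphic_on (cod phi) (fun x => V phi x 0 a)) /\
  (forall phi psi, atlas phi -> atlas psi -> forall x, overlap phi psi x ->
     V psi (transition phi psi x) = V phi x *m 'J (transition phi psi) x).

(* eta(u, v) = u *m eta *m v^T *)
Definition is_bilinear_form (R : realType) (n : nat) (M : complexManifold R n)
    (eta : fields M 'M[Cplx R]_n) : Prop :=
  (forall phi, atlas phi -> forall a b,
     holomorphic_on (cod phi) (fun x => eta phi x a b)) /\
  (forall phi psi, atlas phi -> atlas psi -> forall x, overlap phi psi x ->
     eta phi x = 'J (transition phi psi) x *m eta psi (transition phi psi x)
                 *m ('J (transition phi psi) x)^T).

(* [c a b] is the vector d_a o d_b; [mulv c] is the bilinear extension. *)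
Definition mulv (R : realType) (n : nat) (c : 'I_n -> 'I_n -> 'rV[Cplx R]_n)
    (u v : 'rV[Cplx R]_n) : 'rV[Cplx R]_n :=
  \sum_a \sum_b (u 0 a * v 0 b) *: c a b.

Definition is_product (R : realType) (n : nat) (M : complexManifold R n)
    (c : fields M ('I_n -> 'I_n -> 'rV[Cplx R]_n)) : Prop :=
  (forall phi, atlas phi -> forall a b k,
     holomorphic_on (cod phi) (fun x => c phi x a b 0 k)) /\
  (forall phi psi, atlas phi -> atlas psi -> forall x, overlap phi psi x ->
     forall u v,
     mulv (c phi x) u v *m 'J (transition phi psi) x =
     mulv (c psi (transition phi psi x))
          (u *m 'J (transition phi psi) x) (v *m 'J (transition phi psi) x)).

(* (Lie_V eta)(u, w) = V(eta(u, w)) - eta([V, u], w) - eta(u, [V, w]) and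
   (Lie_V o)(u, w) = [V, u o w] - [V, u] o w - u o [V, w], evaluated at
   u = d_a, w = d_b; recall that [V, d_a] = - \sum_k (d_a V^k) d_k. *)
Definition lie_form (R : realType) (n : nat)
    (V : 'rV[Cplx R]_n -> 'rV[Cplx R]_n) (eta : 'rV[Cplx R]_n -> 'M[Cplx R]_n)
    (x : 'rV[Cplx R]_n) (a b : 'I_n) : Cplx R :=
  'D_(V x) (fun y => eta y a b : Cplx R) x
  + \sum_k (pd a (fun y => V y 0 k) x * eta x k b
            + pd b (fun y => V y 0 k) x * eta x a k).

Definition lie_product (R : realType) (n : nat)
    (V : 'rV[Cplx R]_n -> 'rV[Cplx R]_n)
    (c : 'rV[Cplx R]_n -> 'I_n -> 'I_n -> 'rV[Cplx R]_n)
    (x : 'rV[Cplx R]_n) (a b l : 'I_n) : Cplx R :=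
  'D_(V x) (fun y => c y a b 0 l : Cplx R) x
  + \sum_k (pd a (fun y => V y 0 k) x * c x k b 0 l
            + pd b (fun y => V y 0 k) x * c x a k 0 l
            - c x a b 0 k * pd k (fun y => V y 0 l) x).

Definition flat_chart (R : realType) (n : nat) (M : complexManifold R n)
    (eta : fields M 'M[Cplx R]_n) (phi : chart R n M) : Prop :=
  atlas phi /\
  forall x y, cod phi x -> cod phi y -> eta phi x = eta phi y.

(* The partial derivatives of a holomorphic function are holomorphic, so the
   second and third conditions are automatic; they make sure that all the
   derivatives in the last condition exist. [(c a b *m eta) 0 k] is
   eta(d_a o d_b, d_k). *)
Definition is_potential (R : realType) (n : nat)
    (eta : 'rV[Cplx R]_n -> 'M[Cplx R]_n)
    (c : 'rV[Cplx R]_n -> 'I_n -> 'I_n -> 'rV[Cplx R]_n)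
    (U : set 'rV[Cplx R]_n) (F : 'rV[Cplx R]_n -> Cplx R) : Prop :=
  [/\ holomorphic_on U F,
      forall k, holomorphic_on U (pd k F),
      forall b k, holomorphic_on U (pd b (pd k F)) &
      forall x, U x -> forall a b k,
        (c x a b *m eta x) 0 k = pd a (pd b (pd k F)) x].

Record frobeniusStructure (R : realType) (n : nat) (M : complexManifold R n)
    (d : Cplx R) := FrobeniusStructure {
  metric : fields M 'M[Cplx R]_n;
  prodT : fields M ('I_n -> 'I_n -> 'rV[Cplx R]_n);
  unitF : fields M 'rV[Cplx R]_n;
  eulerF : fields M 'rV[Cplx R]_n;

  metric_form : is_bilinear_form metric;
  metric_sym : forall phi, atlas phi -> forall x, cod phi x ->
    (metric phi x)^T = metric phi x;
  metric_nondegenerate : forall phi, atlas phi -> forall x, cod phi x ->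
    metric phi x \in unitmx;
  metric_flat : forall p : M,
    exists2 phi, flat_chart metric phi & dom phi p;

  prodT_product : is_product prodT;
  prodT_comm : forall phi, atlas phi -> forall x, cod phi x -> forall u v,
    mulv (prodT phi x) u v = mulv (prodT phi x) v u;
  prodT_assoc : forall phi, atlas phi -> forall x, cod phi x -> forall u v w,
    mulv (prodT phi x) (mulv (prodT phi x) u v) w =
    mulv (prodT phi x) u (mulv (prodT phi x) v w);
  prodT_metric : forall phi, atlas phi -> forall x, cod phi x ->
    forall u v w,
    mulv (prodT phi x) u v *m metric phi x *m w^T =
    u *m metric phi x *m (mulv (prodT phi x) v w)^T;

  potential : forall phi, flat_chart metric phi -> forall x, cod phi x ->
    exists U F, [/\ open U, U x, U `<=` cod phi &
                    is_potential (metric phi) (prodT phi) U F];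

  unitF_field : is_vector_field unitF;
  unitF_unit : forall phi, atlas phi -> forall x, cod phi x -> forall v,
    mulv (prodT phi x) (unitF phi x) v = v;
  unitF_flat : forall phi, flat_chart metric phi -> forall x, cod phi x ->
    forall a b, pd a (fun y => unitF phi y 0 b) x = 0;

  eulerF_field : is_vector_field eulerF;
  eulerF_product : forall phi, atlas phi -> forall x, cod phi x ->
    forall a b k,
    lie_product (eulerF phi) (prodT phi) x a b k = prodT phi x a b 0 k;
  eulerF_metric : forall phi, atlas phi -> forall x, cod phi x ->
    forall a b,
    lie_form (eulerF phi) (metric phi) x a b = (2 - d) * metric phi x a b
}.

Definition same_structure (R : realType) (n : nat) (M : complexManifold R n)
    (d : Cplx R) (S S' : frobeniusStructure M d) : Prop :=
  [/\ agree (metric S) (metric S'), agree (prodT S) (prodT S'),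
      agree (unitF S) (unitF S') & agree (eulerF S) (eulerF S')].

(* 1-forms are row vectors of components; the metric identifies the vector [v]
   with the 1-form [v *m eta]. *)
Definition prod_form (R : realType) (n : nat) (M : complexManifold R n)
    (d : Cplx R) (S : frobeniusStructure M d) (phi : chart R n M)
    (x : 'rV[Cplx R]_n) (w1 w2 : 'rV[Cplx R]_n) : 'rV[Cplx R]_n :=
  mulv (prodT S phi x) (w1 *m invmx (metric S phi x))
                       (w2 *m invmx (metric S phi x)) *m metric S phi x.

Definition intersection_form (R : realType) (n : nat) (M : complexManifold R n)
    (d : Cplx R) (S : frobeniusStructure M d) (phi : chart R n M)
    (x : 'rV[Cplx R]_n) (w1 w2 : 'rV[Cplx R]_n) : Cplx R :=
  (prod_form S phi x w1 w2 *m (eulerF S phi x)^T) 0 0.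

Definition muA (a1 a2 a3 : nat) : nat := (a1 + a2 + a3 - 1)%N.

Definition chiA (R : realType) (a1 a2 a3 : nat) : Cplx R :=
  a1%:R^-1 + a2%:R^-1 + a3%:R^-1 - 1.

(* The coordinates are listed in the order t_1, t_{1,1}, ..., t_{1,a1-1},
   t_{2,1}, ..., t_{3,a3-1}, t_mu, numbered from 0 to mu - 1. *)
Definition branch_weights (R : realType) (a : nat) : seq (Cplx R) :=
  [seq (a - j)%N%:R / a%:R | j <- iota 1 (a - 1)].

Definition weights (R : realType) (a1 a2 a3 : nat) : seq (Cplx R) :=
  [:: 1] ++ branch_weights R a1 ++ branch_weights R a2 ++ branch_weights R a3
         ++ [:: 0].

Lemma size_weights (R : realType) (a1 a2 a3 : nat) :
  (0 < a1)%N -> (0 < a2)%N -> (0 < a3)%N ->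
  size (weights R a1 a2 a3) = muA a1 a2 a3.
Proof.
case: a1 a2 a3 => [|a1] [|a2] [|a3] // _ _ _.
by rewrite /muA !size_cat !size_map !size_iota /= !subn1 /= !addSn !addnS
   !addn0 !addnA.
Qed.

Definition triplet_unit (R : realType) (a1 a2 a3 : nat) :
    'rV[Cplx R]_(muA a1 a2 a3) :=
  \row_k ((k : nat) == 0%N)%:R.

Definition triplet_euler (R : realType) (a1 a2 a3 : nat)
    (t : 'rV[Cplx R]_(muA a1 a2 a3)) : 'rV[Cplx R]_(muA a1 a2 a3) :=
  \row_k ((weights R a1 a2 a3)`_k * t 0 k
          + ((k : nat) == (muA a1 a2 a3 - 1)%N)%:R * chiA R a1 a2 a3).

(* Flat coordinates are only required locally around each point; a global
   system of flat coordinates is a particular case. *)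
Definition given_in_flat_coordinates (R : realType) (a1 a2 a3 : nat)
    (M : complexManifold R (muA a1 a2 a3)) (d : Cplx R)
    (S : frobeniusStructure M d) : Prop :=
  forall p : M, exists phi : chart R (muA a1 a2 a3) M,
    [/\ flat_chart (metric S) phi, dom phi p &
        forall t, cod phi t ->
          unitF S phi t = triplet_unit R a1 a2 a3 /\
          eulerF S phi t = triplet_euler t].

(* Main.v *)
Require Import Defs.
From mathcomp Require Import all_boot all_order all_algebra.
From mathcomp Require Import complex.
From mathcomp Require Import all_classical all_reals all_analysis.
From mathcomp Require Import ring.
Set Implicit Arguments.
Unset Strict Implicit.
Unset Printing Implicit Defensive.
Import Order.TTheory GRing.Theory Num.Theory.
Import numFieldNormedType.Exports.
Local Open Scope classical_set_scope.
Local Open Scope ring_scope.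

(** Both structures have the same unit field e and Euler field E, and [e, E] = e.
    In a flat chart where e is the coordinate field d_o, the lowered structure
    constants C_abk = eta(d_a o d_b, d_k) do not depend on the coordinate t_o:
    the functions d_b d_k F have the constant derivatives C_obk = eta_bk along e,
    so their derivatives C_abk are invariant along e. Only the contraction
    with E makes the intersection form depend on t_o, and
      I(t + s e) = I(t) + s eta^-1
    on covectors, for small s ([intersection_form_translate]). The cotangent
    metric eta^-1 is thus the derivative of I along e, and I determines eta.
    A chart that is flat for one metric is flat for the other only once the
    metrics are known to agree, so this comparison is made across a change of
    coordinates; as both unit fields are coordinate fields, the transition
    commutes with small translations along e
    and its Jacobian matrix is invariant under them
    ([constant_derivative_jacobian], [intersection_form_metric]).

    Once the metrics agree, the structures have the same flat charts, and the
    intersection form gives the functions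
      Psi_ab = sum_k C_abk E^k = E(d_a d_b F).
    For E^k = w_k t_k + r_k, differentiating along d_m and using that
    d_m C_abk is symmetric in m and k yields d_m Psi_ab = E(C_abm) + w_m C_abm,
    while homogeneity gives E(C_abm) = (3 - d - w_a - w_b - w_m) C_abm. Hence
      d_m Psi_ab = (3 - d - w_a - w_b) C_abm      ([pd_cubic_euler]),
    which recovers C_abm whenever w_a + w_b <> 3 - d. For the remaining index
    a = o the structure constants are those of the unit: C_obm = eta_bm. With
    d = 1 all weights other than w_o = 1 are smaller than 1, so that
    w_a + w_b < 2 for a <> o, and every C_abm is determined.

    Holomorphic means complex differentiable at each point, and the analysis
    rests on two facts about such functions, both consequences of a mean value
    inequality along complex segments ([mean_value_le]): a function whose
    derivative along u is constant is affine along u, so all its derivatives are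
    invariant along u ([constant_derivative_derive]), and mixed second derivatives commute at a
    point where the first derivatives are differentiable
    ([derive_derive_comm]). *)

(** * Mean values along complex segments *)

Section ComplexMeanValue.
Variables (R : realType) (V : normedModType (Cplx R)).
Local Notation C := (Cplx R).
Local Notation "r %:C" := (real_complex R r : C).
Local Notation Re := (@complex.Re R).

(** The norm of [Cplx R] takes its values in [Cplx R] itself, hence the passage
    between positive reals and positive complex numbers. *)
Lemma Re_continuous : continuous (fun z : C => Re z : R).
Proof.
move=> z; apply/(@cvgrPdist_lt _ _ _ _ (nbhs_filter z)) => e e0.
have e0' : 0 < e%:C by rewrite ltcR.
near=> y.
rewrite -raddfB -ltcR.
apply: le_lt_trans (normc_ge_Re _) _.
near: y.
by have /cvgrPdist_lt/(_ _ e0') := @cvg_id _ (nbhs z).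
Unshelve. all: by end_near. Qed.

Lemma real_complex_continuous : continuous (fun r : R => r%:C).
Proof.
move=> z; apply/(@cvgrPdist_lt _ _ _ _ (nbhs_filter z)) => e e0.
have eR : e = (Re e)%:C.
  by rewrite RRe_real // gtr0_real.
have e0' : 0 < Re e by rewrite -ltcR -eR.
near=> y.
rewrite -rmorphB /= eR.
have -> : `|(z - y)%:C| = `|z - y|%:C :> C.
  by rewrite normc_def /= expr0n addr0 sqrtr_sqr.
rewrite ltcR; near: y.
by have /cvgrPdist_lt/(_ _ e0') := @cvg_id _ (nbhs z).
Unshelve. all: by end_near. Qed.

Lemma is_derive_Re_segment (f : V -> C) (w : C) (x v : V) (t : R) :
  derivable f (x + t%:C *: v) v ->
  is_derive t 1 (fun s : R => Re (w * f (x + s%:C *: v)) : R)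
            (Re (w * 'D_v f (x + t%:C *: v))).
Proof.
set y := x + _ => fd.
have fl : (fun h : C => h^-1 *: (f (h *: v + y) - f y)) @ 0^' --> 'D_v f y
  by exact: fd.
have cl : (fun r : R => r%:C) @ 0^' --> (0 : C)^'.
  move=> A A0.
  have A1 : nbhs (0%:C) [set z : C | z != 0 -> A z] by exact: A0.
  apply: (@filterS _ (nbhs (0 : R)) _ _ _ _ (@real_complex_continuous 0 _ A1)).
  by move=> r /= Ar r0; apply: Ar; apply: contra_neq r0 => /complexI.
have wl : (fun r : R => Re (w * (r%:C^-1 *: (f (r%:C *: v + y) - f y))) : R)
    @ 0^' --> (Re (w * 'D_v f y) : R).
  have := cvg_comp _ _ cl fl => /(cvgMl_tmp (a := w)) /= H.
  exact: (@cvg_comp _ _ _ _ (fun z : C => Re z : R) _ _ _ H (@Re_continuous _)).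
have E : (fun h : R => h^-1 *: (Re (w * f (x + (h *: 1 + t)%:C *: v)) -
     Re (w * f (x + t%:C *: v)))) =
     (fun r : R => Re (w * (r%:C^-1 *: (f (r%:C *: v + y) - f y))) : R).
  apply/funext => r.
  rewrite -raddfB -mulrBr /= -/y.
  have -> : x + (r *: 1 + t)%:C *: v = r%:C *: v + y.
    by rewrite /y [r *: 1]mulr1 rmorphD /= scalerDl addrCA.
  rewrite mulrCA; set z := w * _; symmetry.
  by rewrite -fmorphV; case: z => a b /=; rewrite mul0r subr0.
by move: wl; rewrite -E => {}wl; apply: DeriveDef; [exact: cvgP wl|exact: cvg_lim wl].
Qed.

(** The real mean value theorem applies to the real part of [w * f] for any
    complex [w]; taking for [w] the conjugate of the quantity to be bounded turns
    the bound on a real part into a bound on a modulus. Subtracting the constant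
    [c] makes the statement usable for derivatives close to a given value, and
    [e = 0] covers constant derivatives. *)
Lemma mean_value_le (f : V -> C) (x v : V) (c e : C) :
  (forall t : R, 0 <= t <= 1 -> derivable f (x + t%:C *: v) v) ->
  (forall t : R, 0 <= t <= 1 -> `|'D_v f (x + t%:C *: v) - c| <= e) ->
  `|f (x + v) - f x - c| <= e.
Proof.
move=> fd fe.
set z := _ - c.
have [->|z0] := eqVneq z 0.
  rewrite normr0; apply: le_trans (fe 0 _); rewrite ?normr_ge0 //.
  by rewrite lexx ler01.
set w : C := (z^* )%C.
have [|||t t01] := @MVT_segment R (fun s : R => Re (w * f (x + s%:C *: v)) : R)
  (fun s => Re (w * 'D_v f (x + s%:C *: v))) 0 1.
- exact: ler01.
- move=> t; rewrite in_itv /= => /andP[t0 t1].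
  by apply: is_derive_Re_segment; apply: fd; rewrite !ltW.
- apply: derivable_within_continuous => t; rewrite in_itv /= => t01.
  have := is_derive_Re_segment w (fd _ t01); exact: @ex_derive.
rewrite subr0 mulr1 !rmorph1 !rmorph0 !scale1r !scale0r addr0.
rewrite -raddfB -mulrBr => wE.
have zz : w * z = (`|z| ^+ 2) by rewrite sqr_normc mulrC.
have {}wE : `|z| ^+ 2 = (Re (w * ('D_v f (x + t%:C *: v) - c)))%:C.
  rewrite mulrBr raddfB /= -wE -raddfB -mulrBr /= -/z zz.
  by rewrite RRe_real // ger0_real // exprn_ge0.
have : `|z| ^+ 2 <= `|z| * e.
  rewrite wE; apply: (@le_trans _ _ `|w * ('D_v f (x + t%:C *: v) - c)|).
    by apply: le_trans (normc_ge_Re _); rewrite lecR ler_norm.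
  rewrite normrM normcJ ler_wpM2l // fe //.
by rewrite expr2 ler_pM2l // normr_gt0.
Qed.

Lemma deriveZv (f : V -> C) (x v : V) (s : C) :
  differentiable f x -> 'D_(s *: v) f x = s * 'D_v f x.
Proof. by move=> fd; rewrite !deriveE // linearZ. Qed.

Lemma derive_translate (f : V -> C) (w x v : V) :
  'D_v (fun y => f (y + w)) x = 'D_v f (x + w).
Proof.
rewrite /derive; suff -> : (fun h : C => h^-1 *: (f (h *: v + x + w) - f (x + w))) =
  (fun h : C => h^-1 *: (f (h *: v + (x + w)) - f (x + w))) by [].
by apply/funext => h; rewrite addrA.
Qed.

Lemma differentiable_translate (f : V -> C) (w x : V) :
  differentiable f (x + w) -> differentiable (fun y => f (y + w)) x.
Proof.
move=> fd; apply: (@differentiable_comp _ _ _ _ (fun y => y + w) f) => //.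
Qed.

Lemma real_complex_unit_le (t : R) : 0 <= t <= 1 -> `|t%:C| <= 1.
Proof.
move=> /andP[t0 t1].
by rewrite ger0_norm ?ler0c // -[leRHS](rmorph1 (real_complex R)) lecR.
Qed.

Lemma near_nbhs0 (x : V) (P : V -> Prop) : (\forall y \near x, P y) ->
  exists2 d : C, 0 < d & forall w, `|w| < d -> P (x + w).
Proof.
move=> /nbhs_normP[d d0 dP]; exists d => // w wd; apply: dP.
by rewrite /= opprD addNKr normrN.
Qed.

Lemma near0_lt (e : C) : 0 < e -> \forall s \near (0 : C), `|s| < e.
Proof.
move=> e0; apply/nbhs_normP; exists e => // s /=.
by rewrite sub0r normrN.
Qed.

(** The mean value inequality with zero error along the segment from [y] to
    [y + s u], which stays in the neighborhood where the hypotheses hold. The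
    uniformity in [y] allows the conclusion to be differentiated. *)
Lemma constant_derivative_translate (f : V -> C) (x u : V) (k : C) :
  (\forall y \near x, differentiable f y) ->
  (\forall y \near x, 'D_u f y = k) ->
  \forall s \near (0 : C), \forall y \near x, f (y + s *: u) = f y + s * k.
Proof.
move=> fd fk.
have /near_nbhs0[d d0 dP] : \forall y \near x, differentiable f y /\ 'D_u f y = k.
  by near=> y; split; near: y.
have e0 : 0 < d / 2 / (`|u| + 1).
  by rewrite !divr_gt0 // ltr_wpDl.
near=> s.
have sd : `|s| < d / 2 / (`|u| + 1) by near: s; exact: near0_lt.
rewrite ltr_pdivlMr ?ltr_wpDl // in sd.
have su : `|s *: u| < d / 2.
  rewrite normrZ; apply: le_lt_trans sd.
  by rewrite ler_wpM2l // lerDl.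
apply/nbhs_normP; exists (d / 2) => /=; first by rewrite divr_gt0.
move=> y; rewrite /= => yd.
have seg (t : R) : 0 <= t <= 1 -> differentiable f (y + t%:C *: (s *: u)) /\
    'D_u f (y + t%:C *: (s *: u)) = k.
  move=> t01; have -> : y + t%:C *: (s *: u) = x + (y - x + t%:C *: (s *: u)).
    by rewrite addrA addrCA subrr addr0.
  apply: dP; apply: le_lt_trans (ler_normD _ _) _.
  rewrite (splitr d) distrC; apply: ltr_leD => //.
  rewrite normrZ; apply: le_trans (ltW su).
  by rewrite ler_piMl // real_complex_unit_le.
have : `|f (y + s *: u) - f y - s * k| <= 0.
  apply: mean_value_le => t /seg[fdt fkt]; first exact: diff_derivable.
  by rewrite deriveZv // fkt subrr normr0.
by rewrite normr_le0 -addrA -opprD subr_eq0 => /eqP.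
Unshelve. all: by end_near. Qed.

(** Near [x], the translate of [f] by [s u] differs from [f] by a constant. This
    replaces the commutation of the derivatives along [u] and [v] when
    nothing is known about the differentiability of [D_v f]. *)
Lemma constant_derivative_derive (f : V -> C) (x u : V) (k : C) :
  (\forall y \near x, differentiable f y) ->
  (\forall y \near x, 'D_u f y = k) ->
  \forall s \near (0 : C), f (x + s *: u) = f x + s * k /\
    forall v, 'D_v f (x + s *: u) = 'D_v f x.
Proof.
move=> fd fk; have H := constant_derivative_translate fd fk.
near=> s; have Hs : \forall y \near x, f (y + s *: u) = f y + s * k by near: s.
split=> [|v]; first exact: nbhs_singleton Hs.
rewrite -derive_translate (near_eq_derive _ Hs).
rewrite (@deriveD _ _ _ f (fun=> s * k)).
- by rewrite derive_cst addr0.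
- exact: diff_derivable (nbhs_singleton fd).
- exact: derivable_cst.
Unshelve. all: by end_near. Qed.

(** The second difference is the increment along [h u] of
    [F y = f (y + h v) - f y], whose derivative along [h u] at a point [y] of the
    segment is [h (g (y + h v) - g y)]; differentiability of [g] at [x] alone
    estimates it by [h ^ 2 D_v g x] up to o([h ^ 2]). *)
Lemma second_difference_le (f g : V -> C) (x u v : V) (e : C) :
  (\forall y \near x, differentiable f y) ->
  (\forall y \near x, 'D_u f y = g y) ->
  differentiable g x -> 0 < e ->
  \forall h \near (0 : C),
  `|f (x + h *: v + h *: u) - f (x + h *: u) - (f (x + h *: v) - f x)
    - h ^+ 2 * 'D_v g x| <= e * `|h| ^+ 2.
Proof.
move=> fd fg gd e0.
(* The segment stays within [|h| K] of [x]; the summand 1 keeps [K] positive. *)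
pose K : C := `|u| + `|v| + 1.
have uK : `|u| + `|v| <= K by rewrite /K lerDl.
have K0 : 0 < K by rewrite /K ltr_wpDl // addr_ge0.
have e'0 : 0 < e / 2 / K by rewrite !divr_gt0.
have [d d0 dP] : exists2 d : C, 0 < d & forall w, `|w| < d ->
    [/\ differentiable f (x + w), 'D_u f (x + w) = g (x + w) &
    `|g (x + w) - g x - 'd g x w| <= e / 2 / K * `|w|].
  have g0 : \forall w \near (0 : V),
      `|g (x + w) - g x - 'd g x w| <= e / 2 / K * `|w|.
    have /diff_locallyxC H := gd.
    have cancel (a b c : C) : a + b + c - a - b = c by ring.
    near=> w; rewrite H cancel; near: w.
    by apply: littleoP; rewrite !divr_gt0.
  have f0 : \forall w \near (0 : V),
      differentiable f (x + w) /\ 'D_u f (x + w) = g (x + w).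
    have /near_nbhs0[d d0 dP] :
      \forall y \near x, differentiable f y /\ 'D_u f y = g y.
      by near=> y; split; near: y.
    by apply/nbhs_normP; exists d => // w; rewrite /= sub0r normrN => /dP.
  have /near_nbhs0[d d0 dP] : \forall w \near (0 : V),
    [/\ differentiable f (x + w), 'D_u f (x + w) = g (x + w) &
    `|g (x + w) - g x - 'd g x w| <= e / 2 / K * `|w|].
    near=> w; have [] : differentiable f (x + w) /\ 'D_u f (x + w) = g (x + w).
      by near: w.
    by split => //; near: w.
  by exists d => // w /dP; rewrite add0r.
have dK0 : 0 < d / K by rewrite divr_gt0.
near=> h.
have hd : `|h| < d / K by near: h; exact: near0_lt.
rewrite ltr_pdivlMr // in hd.
have hseg (t t' : R) : 0 <= t <= 1 -> 0 <= t' <= 1 ->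
    `|t%:C *: (h *: u) + t'%:C *: (h *: v)| <= `|h| * K.
  move=> t01 t'01; apply: le_trans (ler_normD _ _) _.
  apply: le_trans (_ : `|h| * (`|u| + `|v|) <= _); last by rewrite ler_wpM2l.
  rewrite mulrDr !normrZ; apply: lerD; rewrite ler_piMl ?mulr_ge0 //;
  exact: real_complex_unit_le.
have seg1 (t : R) : 0 <= t <= 1 -> `|t%:C *: (h *: u)| <= `|h| * K.
  move=> t01; have := hseg t 0 t01; rewrite rmorph0 scale0r addr0; apply.
  by rewrite lexx ler01.
have seg2 (t : R) : 0 <= t <= 1 -> `|t%:C *: (h *: u) + h *: v| <= `|h| * K.
  move=> t01; have := hseg t 1 t01; rewrite rmorph1 scale1r; apply.
  by rewrite lexx ler01.
pose F y := f (y + h *: v) - f y.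
have -> : f (x + h *: v + h *: u) - f (x + h *: u) - (f (x + h *: v) - f x) =
    F (x + h *: u) - F x by rewrite /F (addrAC x (h *: u)).
have Fd (t : R) : 0 <= t <= 1 ->
    differentiable (fun y => f (y + h *: v)) (x + t%:C *: (h *: u)) /\
    differentiable f (x + t%:C *: (h *: u)).
  move=> t01; split.
    apply: differentiable_translate; rewrite -addrA.
    by have [] := dP _ (le_lt_trans (seg2 _ t01) hd).
  by have [] := dP _ (le_lt_trans (seg1 _ t01) hd).
apply: mean_value_le => t t01; have [d1 d2] := Fd t t01.
  by apply: diff_derivable; apply: differentiableB.
rewrite deriveB; [|exact: diff_derivable..].
rewrite !deriveZv // derive_translate -mulrBr -addrA expr2 -mulrA -mulrBr.
have [_ ->] := dP _ (le_lt_trans (seg2 _ t01) hd).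
have [_ ->] := dP _ (le_lt_trans (seg1 _ t01) hd).
set w1 := t%:C *: _; set w2 := w1 + _ => D1 D2.
rewrite normrM [_ ^+ 2]expr2 mulrCA ler_wpM2l //.
have dE : 'd g x w2 = 'd g x w1 + h * 'D_v g x.
  by rewrite /w2 linearD deriveE //; congr (_ + _); rewrite linearZ.
have -> : g (x + w2) - g (x + w1) - h * 'D_v g x =
    (g (x + w2) - g x - 'd g x w2) - (g (x + w1) - g x - 'd g x w1).
  have regroup (a b c p q : C) : a - b - q = (a - c - (p + q)) - (b - c - p).
    by ring.
  by rewrite dE; exact: regroup.
apply: le_trans (ler_normB _ _) _.
have cmp (w : V) : `|w| <= `|h| * K -> e / 2 / K * `|w| <= e / 2 * `|h|.
  move=> wK; apply: le_trans (_ : e / 2 / K * (`|h| * K) <= _).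
    by rewrite ler_wpM2l // ltW.
  by rewrite mulrCA divfK ?gt_eqF // mulrC.
rewrite [e in leRHS]splitr mulrDl; apply: lerD.
  exact: le_trans D2 (cmp _ (seg2 _ t01)).
exact: le_trans D1 (cmp _ (seg1 _ t01)).
Unshelve. all: by end_near. Qed.

(** Young's form of the symmetry of second derivatives: the second difference is
    symmetric in [u] and [v], so [h ^ 2] times either mixed derivative
    approximates it to o([h ^ 2]). The first derivatives are named [gu] and [gv] because they need
    to agree with the given functions near [x] only. *)
Lemma derive_derive_comm (f gu gv : V -> C) (x u v : V) :
  (\forall y \near x, differentiable f y) ->
  (\forall y \near x, 'D_u f y = gu y) ->
  (\forall y \near x, 'D_v f y = gv y) ->
  differentiable gu x -> differentiable gv x ->
  'D_v gu x = 'D_u gv x.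
Proof.
move=> fd fu fv ud vd; apply/eqP; rewrite -subr_eq0 -normr_le0.
apply/ler_addgt0Pl => e e0; rewrite addr0.
have e20 : 0 < e / 2 by rewrite divr_gt0.
have /nbhs_dnbhs D1 := second_difference_le v fd fu ud e20.
have /nbhs_dnbhs D2 := second_difference_le u fd fv vd e20.
have Fd := dnbhs_filter (0 : C).
have D := @filterI _ _ Fd _ _ (@filterI _ _ Fd _ _ D1 D2)
  (nbhs_dnbhs_neq (0 : C)).
have [h [[H1 H2] /= h0]] := @filter_ex _ (0 : C)^' _ _ D.
move: H1 H2 {D1 D2 D} => /=.
rewrite (addrAC x (h *: u)).
have compare (a b c p k L L' N : C) :
    `|a - b - (c - p) - k * L| <= e / 2 * N ->
    `|a - c - (b - p) - k * L'| <= e / 2 * N -> `|k * (L - L')| <= e * N.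
  move=> H1 H2; have -> : k * (L - L') =
      (a - c - (b - p) - k * L') - (a - b - (c - p) - k * L) by ring.
  apply: le_trans (ler_normB _ _) _.
  by rewrite [e]splitr mulrDl lerD.
move=> H1 H2; have := compare _ _ _ _ _ _ _ _ H1 H2.
by rewrite normrM normrX mulrC ler_pM2r // exprn_gt0 // normr_gt0.
Unshelve. all: by end_near. Qed.

End ComplexMeanValue.

(** * Coordinates and Jacobian matrices *)

Section Coordinates.
Variables (R : realType) (n : nat).
Local Notation C := (Cplx R).
Local Notation V := 'rV[C]_n.

Lemma mulv_delta (c : 'I_n -> 'I_n -> V) (a b : 'I_n) :
  mulv c (delta_mx 0 a) (delta_mx 0 b) = c a b.
Proof.
rewrite /mulv (bigD1 a) //= (bigD1 b) //= !mxE !eqxx mulr1 scale1r.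
rewrite !big1 ?addr0 // => i ia.
  by rewrite big1 // => j _; rewrite !mxE (negPf ia) mul0r scale0r.
by rewrite !mxE (negPf ia) mulr0 scale0r.
Qed.

Lemma mulvE (c : 'I_n -> 'I_n -> V) (m : nat) (u v : V) (B : 'M[C]_(n, m)) :
  mulv c u v *m B = \sum_a \sum_b (u 0 a * v 0 b) *: (c a b *m B).
Proof.
rewrite /mulv mulmx_suml; apply: eq_bigr => a _.
by rewrite mulmx_suml; apply: eq_bigr => b _; rewrite -scalemxAl.
Qed.

Lemma derive_entry (T : V -> V) (x v : V) (b : 'I_n) : differentiable T x ->
  'D_v (fun y => T y 0 b : C) x = ('D_v T x) 0 b.
Proof.
move=> /(@diff_derivable _ _ _ T x v) Td; apply: cvg_lim => //.
apply: cvg_trans (cvg_comp _ _ Td (@coord_continuous C 1 n 0 b _)).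
by apply: near_eq_cvg; apply: nearW => h /=; rewrite !mxE.
Qed.

Lemma differentiable_entry (T : V -> V) (x : V) (b : 'I_n) :
  differentiable T x -> differentiable (fun y => T y 0 b : C) x.
Proof.
move=> Td; exact: (differentiable_comp Td (differentiable_coord (T x) 0 b)).
Qed.

Lemma is_derive_affine (w r : 'I_n -> C) (k : 'I_n) (x v : V) :
  is_derive x v (fun y : V => w k * y 0 k + r k) (w k * v 0 k).
Proof.
have D : is_derive x v (fun y : V => y 0 k : C) (v 0 k).
  apply: DeriveDef; first exact/diff_derivable/differentiable_coord.
  by rewrite (@derive_entry id) // derive_id.
have D1 : is_derive x v (w k \*: (fun y : V => y 0 k : C)) (w k *: v 0 k).
  exact: is_deriveZ.
have D2 := is_deriveD D1 (is_derive_cst (r k : C) x v).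
by rewrite addr0 in D2.
Qed.

Lemma near_line (x u : V) (P : V -> Prop) : (\forall y \near x, P y) ->
  \forall s \near (0 : C), P (x + s *: u).
Proof.
move=> Px.
have H : {for (0 : C), continuous (fun s : C => x + s *: u)}.
  apply: (@cvgD _ _ _ (nbhs (0 : C)) _ (fun=> x) (fun s => s *: u) x); first exact: cvg_cst.
  exact: scalel_continuous.
by have := H P; rewrite scale0r addr0; apply.
Qed.

Lemma jacobian_entry (T : V -> V) (x : V) (a b : 'I_n) : differentiable T x ->
  'J T x a b = 'D_(delta_mx 0 a) (fun y => T y 0 b : C) x.
Proof. by move=> Td; rewrite derive_entry // deriveEjacobian // -rowE [RHS]mxE. Qed.

(** A holomorphic map that sends the coordinate field of direction [u] to the
    coordinate field of the same direction commutes with small translations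
    along [u]. *)
Lemma constant_derivative_jacobian (T : V -> V) (x u : V) :
  (\forall y \near x, differentiable T y) ->
  (\forall y \near x, 'D_u T y = u) ->
  \forall s \near (0 : C), T (x + s *: u) = T x + s *: u /\
    'J T (x + s *: u) = 'J T x.
Proof.
move=> Td Tu.
have H b : \forall s \near (0 : C),
    T (x + s *: u) 0 b = T x 0 b + s * u 0 b /\
    forall v, 'D_v (fun y => T y 0 b : C) (x + s *: u) =
              'D_v (fun y => T y 0 b : C) x.
  apply: (constant_derivative_derive (f := fun y => T y 0 b : C)).
    by apply: filterS Td => y; exact: differentiable_entry.
  near=> y; rewrite derive_entry; last by near: y.
  have -> // : 'D_u T y = u by near: y.
have H1 := @filter_forall _ _ _ (nbhs (0 : C)) _ H.
have H2 := near_line u Td.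
near=> s.
have E b : T (x + s *: u) 0 b = T x 0 b + s * u 0 b /\
    forall v, 'D_v (fun y => T y 0 b : C) (x + s *: u) =
              'D_v (fun y => T y 0 b : C) x.
  by move: b; near: s; exact: H1.
split; first by apply/rowP => b; rewrite !mxE; case: (E b).
have Ts : differentiable T (x + s *: u) by near: s.
have T0 : differentiable T x by exact: nbhs_singleton Td.
apply/matrixP => a b; have [_ Eb] := E b.
exact: etrans (jacobian_entry a b Ts) (etrans (Eb _) (esym (jacobian_entry a b T0))).
Unshelve. all: by end_near. Qed.

End Coordinates.

(** * Structure constants in flat coordinates *)

Section StructureConstants.
Variables (R : realType) (n : nat) (M : complexManifold R n) (d : Cplx R).
Variable S : frobeniusStructure M d.
Local Notation C := (Cplx R).
Local Notation V := 'rV[C]_n.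
Implicit Types (phi psi : chart R n M) (x : V) (a b k m o : 'I_n).

(** The totally symmetric tensor eta(d_a o d_b, d_k), equal to the third
    derivatives of the potential in flat coordinates. *)
Definition cubic phi x a b k : C := (prodT S phi x a b *m metric S phi x) 0 k.

Lemma pairing_sym phi x (u v : V) : atlas phi -> cod phi x ->
  (u *m metric S phi x *m v^T) 0 0 = (v *m metric S phi x *m u^T) 0 0.
Proof.
move=> phiA xU; rewrite -[in LHS](Defs.metric_sym S phiA xU).
have -> : u *m (metric S phi x)^T *m v^T = (v *m metric S phi x *m u^T)^T.
  by rewrite !trmx_mul trmxK mulmxA.
by rewrite mxE.
Qed.

Lemma cubicE phi x a b k : cubic phi x a b k =
  (mulv (prodT S phi x) (delta_mx 0 a) (delta_mx 0 b) *m metric S phi x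
    *m (delta_mx 0 k : V)^T) 0 0.
Proof. by rewrite mulv_delta trmx_delta -colE [RHS]mxE. Qed.

(** Together with the commutativity of the product this is total symmetry; the
    cyclic rotation comes from the invariance of the metric. *)
Lemma cubic_rot phi x a b k : atlas phi -> cod phi x ->
  cubic phi x a b k = cubic phi x b k a.
Proof.
move=> phiA xU; rewrite !cubicE.
by rewrite (prodT_metric S phiA xU) pairing_sym.
Qed.

Lemma cubic_unit phi x o b k : atlas phi -> cod phi x ->
  unitF S phi x = delta_mx 0 o -> cubic phi x o b k = metric S phi x b k.
Proof.
move=> phiA xU e0; rewrite /cubic -mulv_delta -e0 (unitF_unit S phiA xU).
by rewrite -rowE mxE.
Qed.

Lemma cubic_differentiable phi x a b k : atlas phi -> cod phi x ->
  differentiable (fun y => cubic phi y a b k) x.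
Proof.
move=> phiA xU.
have -> : (fun y => cubic phi y a b k) =
    \sum_l ((fun y => prodT S phi y a b 0 l) * (fun y => metric S phi y l k)).
  by apply/funext => y; rewrite /cubic mxE fct_sumE.
apply: differentiable_sum => l; apply: differentiableM.
  by have [H _] := prodT_product S; apply: H.
by have [H _] := metric_form S; apply: H.
Qed.

Lemma intersection_formE phi x (w1 w2 : V) :
  intersection_form S phi x w1 w2 =
  \sum_a \sum_b (w1 *m invmx (metric S phi x)) 0 a *
                 (w2 *m invmx (metric S phi x)) 0 b *
     \sum_k cubic phi x a b k * eulerF S phi x 0 k.
Proof.
rewrite /intersection_form /prod_form -mulmxA mulvE !summxE.
apply: eq_bigr => a _; rewrite summxE; apply: eq_bigr => b _.
rewrite [LHS]mxE mulmxA; congr (_ * _); rewrite mxE.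
by apply: eq_bigr => k _; rewrite [X in _ * X]mxE.
Qed.

Lemma near_cod phi x : cod phi x -> \forall y \near x, cod phi y.
Proof. by move=> xU; apply: open_nbhs_nbhs; split => //; exact: open_cod. Qed.

(** The second derivative d_b d_k F of the potential has the constant derivative
    eta_bk along the unit, so its own derivatives are invariant along the unit. *)
Lemma cubic_unit_translate phi x o : flat_chart (metric S) phi -> cod phi x ->
  (forall y, cod phi y -> unitF S phi y = delta_mx 0 o) ->
  \forall s \near (0 : C), forall a b k,
    cubic phi (x + s *: delta_mx 0 o) a b k = cubic phi x a b k.
Proof.
move=> phiF xU e0; have [phiA phic] := phiF.
have [U [F [oU Ux UU [F0 F1 F2 FC]]]] := potential phiF xU.
have nU : \forall y \near x, U y by apply: open_nbhs_nbhs.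
have sU := near_line (delta_mx 0 o) nU.
have H b k : \forall s \near (0 : C), forall a,
    cubic phi (x + s *: delta_mx 0 o) a b k = cubic phi x a b k.
  have := @constant_derivative_derive _ _ (pd b (pd k F)) x (delta_mx 0 o)
     (metric S phi x b k).
  have d1 : \forall y \near x, differentiable (pd b (pd k F)) y.
    by apply: filterS nU => y; exact: F2.
  have d2 : \forall y \near x, 'D_(delta_mx 0 o) (pd b (pd k F)) y =
      metric S phi x b k.
    apply: filterS nU => y Uy; have yU := UU _ Uy.
    rewrite -[LHS]/(pd o (pd b (pd k F)) y) -FC // -/(cubic phi y o b k).
    by rewrite (cubic_unit _ _ phiA yU (e0 _ yU)) (phic _ _ xU yU).
  move=> /(_ d1 d2) D; near=> s => a.
  have Us : U (x + s *: delta_mx 0 o) by near: s.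
  rewrite [LHS](FC _ Us) [RHS](FC _ Ux).
  have [_ Dv] : pd b (pd k F) (x + s *: delta_mx 0 o) =
    pd b (pd k F) x + s * metric S phi x b k /\ forall v,
    'D_v (pd b (pd k F)) (x + s *: delta_mx 0 o) = 'D_v (pd b (pd k F)) x.
    by near: s.
  exact: Dv (delta_mx 0 a).
have H' : \forall s \near (0 : C), forall b k a,
    cubic phi (x + s *: delta_mx 0 o) a b k = cubic phi x a b k.
  exact: (@filter_forall _ _ _ (nbhs (0 : C)) _
    (fun b => @filter_forall _ _ _ (nbhs (0 : C)) _ (H b))).
near=> s => a b k.
have sP : forall b k a,
    cubic phi (x + s *: delta_mx 0 o) a b k = cubic phi x a b k by near: s.
exact: sP.
Unshelve. all: by end_near. Qed.

End StructureConstants.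

(** * The intersection form and the unit field *)

(** Flat charts in which the unit is a coordinate field and the Euler field is
    diagonal: E = sum_k (w_k t_k + r_k) d_k. *)
Definition diagonal_flat_chart (R : realType) (n : nat) (M : complexManifold R n)
    (d : Cplx R) (S : frobeniusStructure M d) (o : 'I_n)
    (w r : 'I_n -> Cplx R) (phi : chart R n M) : Prop :=
  flat_chart (metric S) phi /\
  forall y, cod phi y -> unitF S phi y = delta_mx 0 o /\
    eulerF S phi y = \row_k (w k * y 0 k + r k).

Section IntersectionForm.
Variables (R : realType) (n : nat) (M : complexManifold R n) (d : Cplx R).
Variable S : frobeniusStructure M d.
Local Notation C := (Cplx R).
Local Notation V := 'rV[C]_n.
Implicit Types (phi psi : chart R n M) (x : V) (a b k m o : 'I_n).
Implicit Types (w r : 'I_n -> C).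

Lemma pairingE (g : 'M[C]_n) (u v : V) :
  (u *m g *m v^T) 0 0 = \sum_a \sum_b u 0 a * v 0 b * g a b.
Proof.
rewrite mxE exchange_big /=; apply: eq_bigr => b _.
by rewrite !mxE mulr_suml; apply: eq_bigr => a _; rewrite mulrAC.
Qed.

(** The metric and the structure constants are invariant along the unit, and E
    increases by [s d_o]; contracting with [s d_o] gives [s] times the metric,
    since eta(d_a o d_b, e) = eta(d_a, d_b). *)
Lemma intersection_form_translate phi x o w r :
  diagonal_flat_chart S o w r phi -> w o = 1 -> cod phi x ->
  \forall s \near (0 : C), forall w1 w2 : V,
    intersection_form S phi (x + s *: delta_mx 0 o) w1 w2 =
    intersection_form S phi x w1 w2
      + s * (w1 *m invmx (metric S phi x) *m w2^T) 0 0.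
Proof.
move=> [phiF phiE] w0 xU; have [phiA phic] := phiF.
have e0 y : cod phi y -> unitF S phi y = delta_mx 0 o by move=> /phiE[].
have cT := cubic_unit_translate phiF xU e0.
have uT := near_line (delta_mx 0 o) (near_cod xU).
near=> s => w1 w2.
have sU : cod phi (x + s *: delta_mx 0 o) by near: s.
have sC : forall a b k, cubic S phi (x + s *: delta_mx 0 o) a b k =
    cubic S phi x a b k by near: s.
rewrite !intersection_formE (phic _ _ sU xU).
have -> : (w1 *m invmx (metric S phi x) *m w2^T) 0 0 =
    (w1 *m invmx (metric S phi x) *m metric S phi x
       *m (w2 *m invmx (metric S phi x))^T) 0 0.
  rewrite trmx_mul trmx_inv (Defs.metric_sym S phiA xU) -!mulmxA.
  by rewrite mulKVmx // metric_nondegenerate.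
rewrite pairingE mulr_sumr -big_split; apply: eq_bigr => a _ /=.
rewrite mulr_sumr -big_split; apply: eq_bigr => b _ /=.
have [_ ->] := phiE _ sU; have [_ ->] := phiE _ xU.
have -> : metric S phi x a b = cubic S phi x a b o.
  by rewrite cubic_rot // cubic_rot // (cubic_unit _ _ phiA xU (e0 _ xU)).
rewrite mulrCA -mulrDr; congr (_ * _).
rewrite (bigD1 o) //= [in RHS](bigD1 o) //= !mxE sC !eqxx w0 /=.
set A := \sum_(i < n | i != o) _; set B := \sum_(i < n | i != o) _.
have -> : A = B.
  apply: eq_bigr => i /negPf io; rewrite sC !mxE.
  by rewrite io mulr0 addr0.
by move: (cubic _ _ _ _ _ _) (x 0 o) (r o) => p q t; ring.
Unshelve. all: by end_near. Qed.

(** Invertibility is read off from the metric: J g J^T is nondegenerate. *)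
Lemma jacobian_unit phi psi x : atlas phi -> atlas psi -> overlap phi psi x ->
  'J (transition phi psi) x \in unitmx.
Proof.
move=> phiA psiA xO; have [xU _] := xO.
have [_ /(_ _ _ phiA psiA _ xO) H] := metric_form S.
have := metric_nondegenerate S phiA xU.
by rewrite H !unitmx_mul => /andP[/andP[]].
Qed.

(** The intersection form is a tensor: covectors are pulled back by [w *m J^T]. *)
Lemma intersection_form_transition phi psi x : atlas phi -> atlas psi ->
  overlap phi psi x -> forall w1 w2 : V,
  intersection_form S psi (transition phi psi x) w1 w2 =
  intersection_form S phi x (w1 *m ('J (transition phi psi) x)^T)
                            (w2 *m ('J (transition phi psi) x)^T).
Proof.
move=> phiA psiA xO w1 w2; have Ju := jacobian_unit phiA psiA xO.
have [xU _] := xO; have gu := metric_nondegenerate S phiA xU.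
have [_ /(_ _ _ phiA psiA _ xO) gE] := metric_form S.
have [_ /(_ _ _ phiA psiA _ xO) EE] := eulerF_field S.
have [_ /(_ _ _ phiA psiA _ xO) cE] := prodT_product S.
have raise (w : V) : w *m ('J (transition phi psi) x)^T *m invmx (metric S phi x)
     *m 'J (transition phi psi) x = w *m invmx (metric S psi (transition phi psi x)).
  have := gu; rewrite {1}gE !unitmx_mul => /andP[/andP[_ g'u] JTu].
  (* Raising an index commutes with the change of coordinates. *)
  apply: (can_inj (mulmxK g'u)); apply: (can_inj (mulmxK JTu)).
  have assoc (A B E F : 'M[C]_n) (u : V) : u *m A *m B *m E *m F = u *m A *m (B *m E *m F).
    by rewrite !mulmxA.
  by rewrite mulmxKV // assoc -gE mulmxKV.
by rewrite /intersection_form /prod_form EE -!raise -cE gE trmx_mul !mulmxA.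
Qed.

End IntersectionForm.

(** * The Euler field *)

Section EulerField.
Variables (R : realType) (n : nat) (M : complexManifold R n) (d : Cplx R).
Variable S : frobeniusStructure M d.
Local Notation C := (Cplx R).
Local Notation V := 'rV[C]_n.
Implicit Types (phi psi : chart R n M) (x : V) (a b k m o : 'I_n).

(** Both sides are second derivatives of d_a d_b F. *)
Lemma cubic_closed phi x a b k m : flat_chart (metric S) phi -> cod phi x ->
  pd m (fun y => cubic S phi y a b k) x = pd k (fun y => cubic S phi y a b m) x.
Proof.
move=> phiF xU; have [phiA phic] := phiF.
have [U [F [oU Ux UU [F0 F1 F2 FC]]]] := potential phiF xU.
have nU : \forall y \near x, U y by apply: open_nbhs_nbhs.
have cE j : \forall y \near x,
    'D_(delta_mx 0 j) (pd a (pd b F)) y = cubic S phi y a b j.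
  apply: filterS nU => y Uy; have yU := UU _ Uy.
  by rewrite cubic_rot // cubic_rot // /cubic FC.
apply: (derive_derive_comm (f := pd a (pd b F))).
- by apply: filterS nU => y; exact: F2.
- exact: cE.
- exact: cE.
- exact: cubic_differentiable.
- exact: cubic_differentiable.
Qed.

Lemma sum_pick (f : 'I_n -> C) a : \sum_k (k == a)%:R * f k = f a.
Proof.
rewrite (bigD1 a) //= eqxx mul1r big1 ?addr0 // => k /negPf ->.
by rewrite mul0r.
Qed.

Section Diagonal.
Variables (phi : chart R n M) (o : 'I_n) (w r : 'I_n -> C).
Hypothesis phiD : diagonal_flat_chart S o w r phi.

Lemma pd_euler x a k : cod phi x ->
  pd a (fun y => eulerF S phi y 0 k : C) x = (k == a)%:R * w k.
Proof.
move=> xU; have [phiF phiE] := phiD.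
have H : \forall y \near x, eulerF S phi y 0 k = w k * y 0 k + r k.
  by apply: filterS (near_cod xU) => y /phiE[_ ->]; rewrite mxE.
rewrite /pd (near_eq_derive _ H).
have -> := @derive_val _ _ _ _ _ _ _ (is_derive_affine w r k x (delta_mx 0 a)).
by rewrite mxE eqxx mulrC.
Qed.

(** The equation Lie_E eta = (2 - d) eta for a constant metric: eta pairs
    coordinates whose weights add up to 2 - d. *)
Lemma metric_weight x a b : cod phi x ->
  (w a + w b) * metric S phi x a b = (2 - d) * metric S phi x a b.
Proof.
move=> xU; have [[phiA phic] phiE] := phiD.
rewrite -(eulerF_metric S phiA xU) /lie_form.
have H : \forall y \near x, metric S phi y a b = metric S phi x a b.
  by apply: filterS (near_cod xU) => y yU; rewrite (phic _ _ yU xU).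
rewrite (near_eq_derive _ H) derive_cst add0r big_split /= mulrDl.
congr (_ + _).
  rewrite -(sum_pick (fun k => w k * metric S phi x k b)).
  by apply: eq_bigr => k _; rewrite pd_euler // mulrA.
rewrite -(sum_pick (fun k => w k * metric S phi x a k)).
by apply: eq_bigr => k _; rewrite pd_euler // mulrA.
Qed.

(** Lie_E o = o makes the structure constants c_ab^l homogeneous of degree
    1 - w_a - w_b + w_l, and lowering the index replaces w_l by 2 - d - w_m. *)
Lemma cubic_euler x a b m : cod phi x ->
  'D_(eulerF S phi x) (fun y => cubic S phi y a b m) x =
  (3 - d - w a - w b - w m) * cubic S phi x a b m.
Proof.
move=> xU; have [[phiA phic] phiE] := phiD.
have H : \forall y \near x, cubic S phi y a b m =
    (\sum_l (metric S phi x l m \*: (fun y => prodT S phi y a b 0 l : C))) y.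
  apply: filterS (near_cod xU) => y yU; rewrite /cubic mxE fct_sumE.
  by apply: eq_bigr => l _; rewrite (phic _ _ yU xU) mulrC.
have pd1 l : derivable (fun y => prodT S phi y a b 0 l : C) x (eulerF S phi x).
  by apply: diff_derivable; have [HH _] := prodT_product S; apply: HH.
rewrite (near_eq_derive _ H) derive_sum; last by move=> l; exact: derivableZ.
have D l : 'D_(eulerF S phi x) (fun y => prodT S phi y a b 0 l : C) x =
    (1 - w a - w b + w l) * prodT S phi x a b 0 l.
  have := eulerF_product S phiA xU a b l; rewrite /lie_product.
  have -> : \sum_k (pd a (fun y => eulerF S phi y 0 k) x * prodT S phi x k b 0 l
      + pd b (fun y => eulerF S phi y 0 k) x * prodT S phi x a k 0 l
      - prodT S phi x a b 0 k * pd k (fun y => eulerF S phi y 0 l) x) =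
      w a * prodT S phi x a b 0 l + w b * prodT S phi x a b 0 l
      - w l * prodT S phi x a b 0 l.
    rewrite -(sum_pick (fun k => w k * prodT S phi x k b 0 l)).
    rewrite -(sum_pick (fun k => w k * prodT S phi x a k 0 l)).
    rewrite -(sum_pick (fun k => w l * prodT S phi x a b 0 k) l).
    rewrite -big_split -sumrB /=; apply: eq_bigr => k _.
    rewrite !pd_euler // (eq_sym l k).
    by congr (_ + _ - _); [rewrite -mulrA|rewrite -mulrA|rewrite mulrC -mulrA].
  move=> /eqP; rewrite -subr_eq0 => /eqP E.
  by apply/eqP; rewrite -subr_eq0; apply/eqP; rewrite -[RHS]E; ring.
rewrite /cubic mxE mulr_sumr; apply: eq_bigr => l _.
rewrite deriveZ // D.
have := metric_weight l m xU.
move: (metric S phi x l m) (prodT S phi x a b 0 l) => g c E.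
rewrite -[LHS]/(g * ((1 - w a - w b + w l) * c)).
have -> : (3 - d - w a - w b - w m) * (c * g) =
  (1 - w a - w b - w m) * c * g + c * ((2 - d) * g) by ring.
by rewrite -E; ring.
Qed.

(** The term E(C_abm) arises from the closedness d_m C_abk = d_k C_abm, and the
    term w_m C_abm from differentiating the components of E; the weight of
    [m] cancels. *)
Lemma pd_cubic_euler x a b m : cod phi x ->
  pd m (fun y => \sum_k cubic S phi y a b k * eulerF S phi y 0 k) x =
  (3 - d - w a - w b) * cubic S phi x a b m.
Proof.
move=> xU; have [phiF phiE] := phiD; have [phiA phic] := phiF.
have H : \forall y \near x, \sum_k cubic S phi y a b k * eulerF S phi y 0 k =
    (\sum_k ((fun y => cubic S phi y a b k) * (fun y => w k * y 0 k + r k) : V -> C)) y.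
  apply: filterS (near_cod xU) => y /phiE[_ yE]; rewrite fct_sumE.
  by apply: eq_bigr => k _; rewrite yE mxE.
have cd k : differentiable (fun y => cubic S phi y a b k) x.
  exact: cubic_differentiable.
have Ed k : derivable (fun y : V => w k * y 0 k + r k : C) x (delta_mx 0 m).
  exact: (@ex_derive _ _ _ _ _ _ _ (is_derive_affine w r k x (delta_mx 0 m))).
rewrite /pd (near_eq_derive _ H) derive_sum; last first.
  by move=> k; apply: derivableM => //; exact: diff_derivable.
have D k : 'D_(delta_mx 0 m) ((fun y => cubic S phi y a b k) *
      (fun y => w k * y 0 k + r k) : V -> C) x =
    (k == m)%:R * (w k * cubic S phi x a b k) +
    eulerF S phi x 0 k * pd k (fun y => cubic S phi y a b m) x.
  rewrite (deriveM (diff_derivable (cd k)) (Ed k)).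
  rewrite -(cubic_closed a b k m phiF xU).
  have -> := @derive_val _ _ _ _ _ _ _ (is_derive_affine w r k x (delta_mx 0 m)).
  have [_ ->] := phiE _ xU; rewrite !mxE eqxx /=.
  rewrite -[cubic S phi x a b k *: _]/(cubic S phi x a b k * _).
  by congr (_ + _); rewrite mulrC -mulrA mulrCA.
rewrite (eq_bigr _ (fun k _ => D k)) big_split /= sum_pick.
have -> : \sum_k eulerF S phi x 0 k * pd k (fun y => cubic S phi y a b m) x =
    'D_(eulerF S phi x) (fun y => cubic S phi y a b m) x.
  rewrite deriveE // [in RHS](row_sum_delta (eulerF S phi x)) linear_sum /=.
  by apply: eq_bigr => k _; rewrite linearZ /= /pd deriveE.
by rewrite cubic_euler //; ring.
Qed.
End Diagonal.

End EulerField.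

(** * Uniqueness *)

Section Uniqueness.
Variables (R : realType) (n : nat) (M : complexManifold R n) (d : Cplx R).
Local Notation C := (Cplx R).
Local Notation V := 'rV[C]_n.
Implicit Types (phi psi : chart R n M) (x : V) (a b k m o : 'I_n).
Implicit Types (S : frobeniusStructure M d).

Lemma near_overlap phi psi x : overlap phi psi x ->
  \forall y \near x, overlap phi psi y.
Proof.
move=> [xU px]; near=> y; split; near: y; first exact: near_cod.
have := @continuous_param _ _ _ phi.
rewrite (continuous_open_subspace _ (@open_cod _ _ _ phi)) => /(_ x).
rewrite inE => /(_ xU) H; apply: H.
by apply: open_nbhs_nbhs; split => //; exact: open_dom.
Unshelve. all: by end_near. Qed.

Lemma transition_overlap phi psi x : cod psi x -> dom phi (param psi x) ->
  overlap psi phi x /\ cod phi (transition psi phi x) /\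
  param phi (transition psi phi x) = param psi x.
Proof.
move=> xU px; split=> //; split; first exact: coord_cod.
exact: coordK.
Qed.

(** The cotangent metrics are the derivatives along the unit of one and the same
    form, compared through the transition between a chart adapted to [S] and a
    chart adapted to [S']. As everything is affine in the translation parameter,
    evaluation at a single small nonzero [s] suffices. *)
Lemma intersection_form_metric S S' (o : 'I_n) (w r w' r' : 'I_n -> C) phi psi x :
  diagonal_flat_chart S o w r phi -> w o = 1 ->
  diagonal_flat_chart S' o w' r' psi -> w' o = 1 ->
  agree (unitF S) (unitF S') ->
  agree (intersection_form S) (intersection_form S') ->
  overlap phi psi x -> metric S phi x = metric S' phi x.
Proof.
move=> phiD w0 psiD w'0 sameu sameI xO.
have [[phiA _] phiE] := phiD; have [[psiA _] psiE] := psiD.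
have [xU xV] := xO.
pose T := transition phi psi.
have TU y : overlap phi psi y -> cod psi (T y) by case=> _; exact: coord_cod.
have [Td _] := atlas_compatible phiA psiA.
have nO := near_overlap xO.
have Tdn : \forall y \near x, differentiable T y by apply: filterS nO => y /Td.
have Te : \forall y \near x, 'D_(delta_mx 0 o) T y = delta_mx 0 o.
  apply: filterS nO => y yO; rewrite deriveEjacobian; last exact: Td.
  have [yU _] := yO.
  have [_ /(_ _ _ phiA psiA _ yO)] := unitF_field S.
  have [-> _] := phiE _ yU; rewrite -/T => <-.
  by rewrite (sameu _ psiA _ (TU _ yO)); have [] := psiE _ (TU _ yO).
have sT := constant_derivative_jacobian Tdn Te.
have sI := intersection_form_translate phiD w0 xU.
have sI' := intersection_form_translate psiD w'0 (TU _ xO).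
have sO := near_line (delta_mx 0 o) nO.
set e : V := delta_mx 0 o in Te sT sI sI' sO *.
have near0 := nbhs_filter (0 : C).
have sOT := @filterI _ _ near0 _ _ sO sT.
have sII' := @filterI _ _ near0 _ _ sI sI'.
have sP := @filterI _ _ (dnbhs_filter (0 : C)) _ _
  (nbhs_dnbhs (@filterI _ _ near0 _ _ sOT sII')) (nbhs_dnbhs_neq (0 : C)).
have [s [[[yO [Ty Jy]] [Iy I'y]] s0]] := @filter_ex _ (0 : C)^' _ _ sP.
pose J := 'J T x.
have Ju : J \in unitmx by exact: (jacobian_unit S phiA psiA xO).
(* Subtract the values at [x] from those at [x + s e] and divide by [s]. *)
have gE : J^T *m invmx (metric S phi x) *m J = invmx (metric S' psi (T x)).
  apply/matrixP => a b.
  have E := intersection_form_transition S phiA psiA yO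
    (delta_mx 0 a) (delta_mx 0 b).
  have E0 := intersection_form_transition S phiA psiA xO
    (delta_mx 0 a) (delta_mx 0 b).
  rewrite -/T Jy Ty Iy -/J in E; rewrite -/T -/J in E0.
  have TyU : cod psi (T x + s *: e) by rewrite -Ty; exact: TU.
  rewrite (sameI _ psiA _ TyU) I'y -(sameI _ psiA _ (TU _ xO)) E0 in E.
  have entry (A : 'M[C]_n) :
      ((delta_mx 0 a : V) *m A *m (delta_mx 0 b : V)^T) 0 0 = A a b.
    by rewrite trmx_delta -rowE -colE !mxE.
  move/addrI/(mulfI s0): E; rewrite entry => ->.
  by rewrite trmx_mul trmxK -[LHS]entry !mulmxA.
have [_ /(_ _ _ phiA psiA _ xO) ->] := metric_form S'.
rewrite -/T -/J -[metric S' psi _]invmxK -gE.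
have gu := metric_nondegenerate S phiA xU.
have Vu : J^T *m invmx (metric S phi x) *m J \in unitmx.
  by rewrite !unitmx_mul unitmx_tr Ju unitmx_inv gu.
have gVu : invmx (metric S phi x) \in unitmx by rewrite unitmx_inv.
apply: (can_inj (mulmxK gVu)); apply: (can_inj (mulmxK Ju)).
rewrite (mulmxV gu) mul1mx -[LHS]mulmx1 -(mulVmx Vu).
by rewrite !mulmxA.
Unshelve. all: by end_near. Qed.

Lemma intersection_form_lower S phi x a b : atlas phi -> cod phi x ->
  intersection_form S phi x (delta_mx 0 a *m metric S phi x)
                            (delta_mx 0 b *m metric S phi x) =
  \sum_k cubic S phi x a b k * eulerF S phi x 0 k.
Proof.
move=> phiA xU; have gu := metric_nondegenerate S phiA xU.
rewrite /intersection_form /prod_form !mulmxK // mulv_delta mxE.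
by apply: eq_bigr => k _; rewrite [X in _ * X]mxE.
Qed.

(** The general form of the uniqueness statement: the intersection form determines
    the structure as soon as no pair of weights, except possibly the pair
    formed by [w o] and itself, adds up to 3 - d. *)
Theorem diagonal_frobenius_unique S S' (o : 'I_n) (w r : 'I_n -> C) :
  (forall p : M, exists2 phi, diagonal_flat_chart S o w r phi & dom phi p) ->
  (forall p : M, exists2 phi, diagonal_flat_chart S' o w r phi & dom phi p) ->
  w o = 1 -> (forall a b, a != o -> w a + w b != 3 - d) ->
  agree (unitF S) (unitF S') -> agree (eulerF S) (eulerF S') ->
  agree (intersection_form S) (intersection_form S') ->
  same_structure S S'.
Proof.
move=> SD S'D w0 wab sameu sameE sameI.
have sameg : agree (metric S) (metric S').
  move=> psi psiA x xU.
  have [phi phiD pphi] := SD (param psi x).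
  have [phi' phi'D pphi'] := S'D (param psi x).
  have [phiA _] := phiD.1.
  have [xO [yU yp]] := transition_overlap xU pphi.
  have [_ /(_ _ _ psiA phiA _ xO) ->] := metric_form S.
  have [_ /(_ _ _ psiA phiA _ xO) ->] := metric_form S'.
  congr (_ *m _ *m _).
  apply: (intersection_form_metric phiD w0 phi'D w0 sameu sameI).
  by split => //; rewrite yp.
have samec : forall phi, diagonal_flat_chart S o w r phi ->
    forall y, cod phi y -> prodT S phi y = prodT S' phi y.
  move=> phi phiD y yU; have [[phiA phic] phiE] := phiD.
  have phiD' : diagonal_flat_chart S' o w r phi.
    split; first by split => // z t zU tU; rewrite -!sameg //; exact: phic.
    by move=> z zU; rewrite -(sameu _ phiA _ zU) -(sameE _ phiA _ zU); exact: phiE.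
  have cubicE a b k : cubic S phi y a b k = cubic S' phi y a b k.
    have [ao|ao] := eqVneq a o.
      rewrite ao (cubic_unit _ _ phiA yU (phiE _ yU).1).
      by rewrite (cubic_unit _ _ phiA yU (phiD'.2 _ yU).1) sameg.
    (* The metrics agree, so both forms can be evaluated on the same lowered
       coordinate vectors. *)
    have H : \forall z \near y,
        \sum_k cubic S phi z a b k * eulerF S phi z 0 k =
        \sum_k cubic S' phi z a b k * eulerF S' phi z 0 k.
      apply: filterS (near_cod yU) => z zU.
      rewrite -(intersection_form_lower S _ _ phiA zU).
      rewrite -(intersection_form_lower S' _ _ phiA zU).
      by rewrite -(sameg _ phiA _ zU) (sameI _ phiA _ zU).
    have wn0 : 3 - d - w a - w b != 0.
      by rewrite -addrA -opprD subr_eq0 eq_sym wab.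
    apply: (mulfI wn0); rewrite -(pd_cubic_euler phiD a b k yU).
    by rewrite -(pd_cubic_euler phiD' a b k yU) /pd (near_eq_derive _ H).
  apply/funext => a; apply/funext => b.
  apply: (can_inj (mulmxK (metric_nondegenerate S phiA yU))).
  apply/rowP => k; rewrite [in RHS](sameg _ phiA _ yU).
  exact: cubicE.
split => // psi psiA x xU.
have [phi phiD pphi] := SD (param psi x).
have [phiA _] := phiD.1.
have [xO [yU _]] := transition_overlap xU pphi.
have Ju := jacobian_unit S psiA phiA xO.
apply/funext => a; apply/funext => b; rewrite -!mulv_delta.
apply: (can_inj (mulmxK Ju)).
have [_ /(_ _ _ psiA phiA _ xO) ->] := prodT_product S.
have [_ /(_ _ _ psiA phiA _ xO) ->] := prodT_product S'.
by rewrite (samec _ phiD _ yU).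
Qed.

End Uniqueness.

Lemma weights_lt1 (R : realType) (a1 a2 a3 k : nat) : k != 0%N ->
  (weights R a1 a2 a3)`_k < 1.
Proof.
case: k => // k _; rewrite /weights /=.
have branch a : all (fun z : Cplx R => z < 1) (branch_weights R a).
  apply/allP => z /mapP[j]; rewrite mem_iota => /andP[j1 ja] ->.
  have a0 : (0 < a)%N by case: (a) ja j1 => //; case: j.
  by rewrite ltr_pdivrMr ?ltr0n // mul1r ltr_nat ltn_subrL a0 j1.
(* The default value 0 of [nth] is also less than 1. *)
set s := _ ++ _.
have sP : all (fun z : Cplx R => z < 1) s by rewrite !all_cat !branch /= ltr01.
have [ks|sk] := ltnP k (size s); first by have /all_nthP := sP; apply.
by rewrite nth_default // ltr01.
Qed.

Theorem theorem7p1 (R : realType) (a1 a2 a3 : nat)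
    (a1_gt0 : (0 < a1)%N) (a1_le_a2 : (a1 <= a2)%N) (a2_le_a3 : (a2 <= a3)%N)
    (M : complexManifold R (muA a1 a2 a3))
    (S S' : frobeniusStructure M 1)
    (S_flat : given_in_flat_coordinates S)
    (S'_flat : given_in_flat_coordinates S')
    (same_unit : agree (unitF S) (unitF S'))
    (same_euler : agree (eulerF S) (eulerF S'))
    (same_intersection : agree (intersection_form S) (intersection_form S')) :
  same_structure S S'.
Proof.
have [a2_gt0 a3_gt0] : (0 < a2)%N /\ (0 < a3)%N.
  have a2_gt0 := leq_trans a1_gt0 a1_le_a2.
  by split=> //; exact: leq_trans a2_gt0 a2_le_a3.
have mu_gt1 : (1 < muA a1 a2 a3)%N.
  rewrite /muA ltn_subRL; apply: (@leq_add 2 1) => //.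
  exact: (@leq_add 1 1).
pose o := Ordinal (ltnW mu_gt1).
pose w (k : 'I_(muA a1 a2 a3)) : Cplx R := (weights R a1 a2 a3)`_k.
pose r (k : 'I_(muA a1 a2 a3)) : Cplx R :=
  ((k : nat) == (muA a1 a2 a3 - 1)%N)%:R * chiA R a1 a2 a3.
have diagonal (T : frobeniusStructure M 1) : given_in_flat_coordinates T ->
    forall p : M, exists2 phi, diagonal_flat_chart T o w r phi & dom phi p.
  move=> T_flat p; have [phi [phiF pphi phiE]] := T_flat p; exists phi => //.
  split=> // y /phiE[-> ->]; split => //.
  by apply/rowP => k; rewrite !mxE eqxx.
apply: (diagonal_frobenius_unique (diagonal S S_flat) (diagonal S' S'_flat)) => //.
move=> a b ao; have -> : 3 - 1 = 1 + 1 :> Cplx R by ring.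
have wa : w a < 1 by apply: weights_lt1.
have wb : w b <= 1.
  by have [->|bo] := eqVneq b o; [|apply/ltW/weights_lt1].
by rewrite lt_eqF // ltr_leD.
Qed.
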